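(* Let $A\subseteq B$ be a ring extension such that some maximal ideal $M$ of $B$ is contained in $A$. Then the extension of formal power series rings $A[[X]]\subseteq B[[X]]$ is a PSI-extension.
   Context: All rings are commutative and unitary, and ring morphisms are unitary. For a ring extension $C\subseteq D$, a proper ideal $I$ of $D$ is called $C$-prime if $cd\in I$ with $c\in C$ and $d\in D$ implies that $c\in I$ or $d\in I$. The extension $C\subseteq D$ is a PSI-extension if every $C$-prime ideal of $D$ is a prime ideal of $D$. $X$ is an indeterminate. *)

(* Defs.v *)
From HB Require Import structures.
From mathcomp Require Import all_boot all_algebra.
From mathcomp Require Import boolp.

Set Implicit Arguments.
Unset Strict Implicit.
Unset Printing Implicit Defensive.

Import GRing.Theory.
Local Open Scope ring_scope.

(* Subsets of a ring are boolean predicates, as in ring_quotient; by boolp's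
   [`[< _ >]] every Prop-valued predicate is of this form, so no decidability
   is being assumed of ideals and subrings. *)

Section Ideals.
Variable D : comNzRingType.
Implicit Types C I M J : {pred D}.

(* [idealr_closed] includes properness. *)
Definition prime_ideal I : Prop := idealr_closed I /\ prime_idealr_closed I.

Definition maximal_ideal M : Prop :=
  idealr_closed M /\
  forall J, idealr_closed J -> {subset M <= J} -> J =i M.

Definition relative_prime_ideal C I : Prop :=
  idealr_closed I /\
  forall c d : D, c \in C -> c * d \in I -> c \in I \/ d \in I.

Definition PSI_extension (C : subringClosed D) : Prop :=
  forall I, relative_prime_ideal C I -> prime_ideal I.

End Ideals.

Record fps (R : Type) : Type := Fps { fps_coef :> nat -> R }.

Notation "{ 'fps' R }" := (fps R) (at level 0, format "{ 'fps'  R }").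

HB.instance Definition _ (R : Type) := gen_eqMixin (fps R).
HB.instance Definition _ (R : Type) := gen_choiceMixin (fps R).

Lemma fpsP (R : Type) (f g : {fps R}) : (forall n, f n = g n) <-> f = g.
Proof.
split=> [|-> //]; case: f g => [f] [g] /= fg.
by congr Fps; apply/funext.
Qed.

Section FpsRing.
Variable R : comNzRingType.
Implicit Types f g h : {fps R}.

Definition zero_fps : {fps R} := Fps (fun=> 0).
Definition opp_fps f : {fps R} := Fps (fun n => - f n).
Definition add_fps f g : {fps R} := Fps (fun n => f n + g n).
Definition one_fps : {fps R} := Fps (fun n => (n == 0%N)%:R).
Definition mul_fps f g : {fps R} :=
  Fps (fun n => \sum_(i < n.+1) f i * g (n - i)%N).

Fact add_fpsA : associative add_fps.
Proof. by move=> f g h; apply/fpsP => n /=; rewrite addrA. Qed.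

Fact add_fpsC : commutative add_fps.
Proof. by move=> f g; apply/fpsP => n /=; rewrite addrC. Qed.

Fact add_0fps : left_id zero_fps add_fps.
Proof. by move=> f; apply/fpsP => n /=; rewrite add0r. Qed.

Fact add_Nfps : left_inverse zero_fps opp_fps add_fps.
Proof. by move=> f; apply/fpsP => n /=; rewrite addNr. Qed.

HB.instance Definition _ :=
  GRing.isZmodule.Build (fps R) add_fpsA add_fpsC add_0fps add_Nfps.

Fact mul_fpsC : commutative mul_fps.
Proof.
move=> f g; apply/fpsP => n /=; rewrite (reindex_inj rev_ord_inj) /=.
by apply: eq_bigr => i _; rewrite (sub_ordK i) mulrC.
Qed.

Fact mul_fpsE f g n : mul_fps f g n = \sum_(i < n.+1) f i * g (n - i)%N.
Proof. by []. Qed.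

Fact mul_fps_rev f g n :
  mul_fps f g n = \sum_(i < n.+1) f (n - i)%N * g i.
Proof. by rewrite mul_fpsC /=; apply: eq_bigr => i _; rewrite mulrC. Qed.

Fact mul_fpsA : associative mul_fps.
Proof.
move=> f g h; apply/fpsP => i; rewrite [RHS]mul_fps_rev mul_fpsE.
pose coef3 j k := f j * (g (i - j - k)%N * h k).
transitivity (\sum_(j < i.+1) \sum_(k < i.+1 | (k <= i - j)%N) coef3 j k).
  apply: eq_bigr => j _; rewrite mul_fps_rev big_distrr /=.
  by rewrite (big_ord_narrow_leq (leq_subr _ _)).
rewrite (exchange_big_dep predT) //=; apply: eq_bigr => k _.
transitivity (\sum_(j < i.+1 | (j <= i - k)%N) coef3 j k).
  apply: eq_bigl => j; rewrite -ltnS -(ltnS j) -!subSn ?leq_ord //.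
  by rewrite -subn_gt0 -(subn_gt0 j) -!subnDA addnC.
rewrite (big_ord_narrow_leq (leq_subr _ _)) big_distrl /=.
by apply: eq_bigr => j _; rewrite /coef3 -!subnDA addnC mulrA.
Qed.

Fact mul_1fps : left_id one_fps mul_fps.
Proof.
move=> f; apply/fpsP => n /=; rewrite big_ord_recl mul1r subn0.
by rewrite big1 ?addr0 // => i _; rewrite mul0r.
Qed.

Fact mul_fpsDl : left_distributive mul_fps add_fps.
Proof.
move=> f g h; apply/fpsP => n /=; rewrite -big_split /=.
by apply: eq_bigr => i _; rewrite mulrDl.
Qed.

Fact fps1_neq0 : one_fps != 0.
Proof.
by apply/eqP => /fpsP /(_ 0%N) /= /eqP; rewrite oner_eq0.
Qed.

HB.instance Definition _ := GRing.Zmodule_isComNzRing.Build (fps R)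
  mul_fpsA mul_fpsC mul_1fps mul_fpsDl fps1_neq0.

Lemma coef_fps0 n : (0 : {fps R}) n = 0. Proof. by []. Qed.
Lemma coef_fps1 n : (1 : {fps R}) n = (n == 0%N)%:R. Proof. by []. Qed.
Lemma coef_fpsN f n : (- f) n = - f n. Proof. by []. Qed.
Lemma coef_fpsD f g n : (f + g) n = f n + g n. Proof. by []. Qed.
Lemma coef_fpsB f g n : (f - g) n = f n - g n. Proof. by []. Qed.
Lemma coef_fpsM f g n : (f * g) n = \sum_(i < n.+1) f i * g (n - i)%N.
Proof. by []. Qed.

End FpsRing.

Definition fps_over (R : Type) (A : {pred R}) : {pred {fps R}} :=
  fun f => `[< forall n, f n \in A >].

Lemma fps_overP (R : Type) (A : {pred R}) (f : {fps R}) :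
  reflect (forall n, f n \in A) (f \in fps_over A).
Proof. exact: asboolP. Qed.

Section FpsOverSubring.
Variables (R : comNzRingType) (A : subringClosed R).

Fact fps_over_subring_closed : subring_closed (fps_over A).
Proof.
split=> [|f g /fps_overP Af /fps_overP Ag|f g /fps_overP Af /fps_overP Ag].
- by apply/fps_overP => n; rewrite coef_fps1 rpred_nat.
- by apply/fps_overP => n; rewrite coef_fpsB rpredB.
- by apply/fps_overP => n; rewrite coef_fpsM rpred_sum // => i _; rewrite rpredM.
Qed.

HB.instance Definition _ :=
  GRing.isSubringClosed.Build {fps R} (fps_over A) fps_over_subring_closed.

End FpsOverSubring.

(* Main.v *)
Require Import Defs.
From mathcomp Require Import all_boot all_algebra.
From mathcomp Require Import boolp.

(** Write [M[[X]]] for the series with coefficients in [M]; it is an ideal of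
    [B[[X]]] contained in [A[[X]]]. Let [P] be an [A[[X]]]-prime ideal of
    [B[[X]]].

    If [P] misses some [m] in [M[[X]]], then [P] is prime because [m] conducts
    [B[[X]]] into [A[[X]]]: from [f * g] in [P] follows [(m * f) * g] in [P]
    with [m * f] in [A[[X]]], so that [g] or [m * f] is in [P], and in the
    latter case [f] is ([relative_prime_conductor]).

    If [P] contains [M[[X]]], it is enough to reason modulo [M[[X]]], that is,
    in the power series ring over the field [B / M]. There every nonzero [f]
    is a unit times some ['X^n] ([fps_assoc_monomial]), so [f * g] in [P] gives
    ['X^n * g] in [P]. As ['X^n] has coefficients 0 and 1, it lies in
    [A[[X]]], whence [g] or ['X^n] is in [P]; in the second case so is [f]. *)

Set Implicit Arguments.
Unset Strict Implicit.
Unset Printing Implicit Defensive.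

Import GRing.Theory.
Local Open Scope ring_scope.

Section IdealClosure.
Variables (R : comNzRingType) (I : {pred R}).
Hypothesis idI : idealr_closed I.

Lemma ideal_mem0 : 0 \in I.
Proof. by case: idI. Qed.

Lemma ideal_memMl a x : x \in I -> a * x \in I.
Proof.
by case: idI => I0 _ IMD Ix; rewrite -[a * x]addr0; apply: IMD.
Qed.

Lemma ideal_memD x y : x \in I -> y \in I -> x + y \in I.
Proof. by case: idI => _ _ IMD Ix Iy; rewrite -[x]mul1r; apply: IMD. Qed.

Lemma ideal_memB x y : x \in I -> y \in I -> x - y \in I.
Proof.
by move=> Ix Iy; apply: ideal_memD => //; rewrite -mulN1r; apply: ideal_memMl.
Qed.

Lemma ideal_mem_sum n (F : 'I_n -> R) :
  (forall i, F i \in I) -> \sum_(i < n) F i \in I.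
Proof.
by move=> IF; apply: (big_ind (fun x => x \in I));
  [exact: ideal_mem0 | exact: ideal_memD | move=> i _; exact: IF].
Qed.

Lemma ideal_mem_congr x y : x - y \in I -> (x \in I) = (y \in I).
Proof.
move=> Ixy; apply/idP/idP => [Ix|Iy].
  by rewrite -[y](subKr x); apply: ideal_memB.
by rewrite -[x](subrK y); apply: ideal_memD.
Qed.

End IdealClosure.

(** The ideal [M + (x)] properly contains [M], so maximality forces it to
    contain 1. *)
Lemma maximal_ideal_inv (R : comNzRingType) (M : {pred R}) (x : R) :
  maximal_ideal M -> x \notin M -> exists b, x * b - 1 \in M.
Proof.
move=> [idM maxM] Mx; apply: contrapT => noinv.
pose J : {pred R} := fun y => `[< exists b, y - x * b \in M >].
have JP y : reflect (exists b, y - x * b \in M) (y \in J) by exact: asboolP.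
have idJ : idealr_closed J.
  split=> [||a u v /JP[b Mu] /JP[c Mv]].
  - by apply/JP; exists 0; rewrite mulr0 subr0; apply: ideal_mem0.
  - apply/negP => /JP[b Mb]; apply: noinv; exists b.
    by rewrite -opprB -mulN1r; apply: ideal_memMl.
  - apply/JP; exists (a * b + c).
    rewrite mulrDr opprD addrACA mulrCA -mulrBr.
    by apply: ideal_memD => //; apply: ideal_memMl.
have MJ : {subset M <= J}.
  by move=> y My; apply/JP; exists 0; rewrite mulr0 subr0.
move/negP: Mx; apply; rewrite -(maxM J idJ MJ x).
by apply/JP; exists 1; rewrite mulr1 subrr; apply: ideal_mem0.
Qed.

(** If [I] misses an element [m] of an ideal [J] lying inside [C], then
    multiplication by [m] turns any factor into an element of [C], to which
    the relative primality of [I] applies. *)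
Lemma relative_prime_conductor (D : comNzRingType) (C I J : {pred D}) (m : D) :
    relative_prime_ideal C I -> idealr_closed J -> {subset J <= C} ->
  m \in J -> m \notin I -> prime_ideal I.
Proof.
move=> [idI primeI] idJ JC Jm Im; split=> // f g Ifg; apply/orP.
have Cmf : m * f \in C by apply: JC; rewrite mulrC; apply: ideal_memMl.
have Imfg : (m * f) * g \in I by rewrite -mulrA; apply: ideal_memMl.
have [Imf|] := primeI _ _ Cmf Imfg; last by right.
by have [/(negP Im)|] := primeI _ _ (JC _ Jm) Imf; last by left.
Qed.

Section PowerSeries.
Variable R : comNzRingType.
Implicit Types (f g : {fps R}) (n : nat).

Definition fpsXn n : {fps R} := Fps (fun k => (k == n)%:R).

Lemma coef_fpsXnM n f k :
  (fpsXn n * f) k = if (n <= k)%N then f (k - n)%N else 0.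
Proof.
rewrite coef_fpsM /=; case: leqP => [lenk|ltkn].
  rewrite (bigD1 (Ordinal (lenk : (n < k.+1)%N))) //= eqxx mul1r.
  rewrite big1 ?addr0 // => i; rewrite -val_eqE /= => /negPf->.
  by rewrite mul0r.
rewrite big1 // => i _; rewrite ltn_eqF ?mul0r //.
exact: leq_ltn_trans (leq_ord i) ltkn.
Qed.

Lemma fpsXn_over (A : subringClosed R) n : fpsXn n \in fps_over A.
Proof. by apply/fps_overP => k; rewrite rpred_nat. Qed.

Lemma fps_over_ideal (I : {pred R}) :
  idealr_closed I -> idealr_closed (fps_over I).
Proof.
move=> idI; split=> [||a u v /fps_overP Iu /fps_overP Iv].
- by apply/fps_overP => n; apply: ideal_mem0.
- apply/negP => /fps_overP/(_ 0%N); rewrite coef_fps1 eqxx.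
  by case: idI => _ /negP.
- apply/fps_overP => n; rewrite coef_fpsD coef_fpsM.
  apply: ideal_memD => //; apply: ideal_mem_sum => // i.
  exact: ideal_memMl.
Qed.

(** Coefficients of a formal inverse of [f], for [b] an approximate inverse of
    [f 0]: coefficient [n] is [b] times what the earlier ones leave of the
    coefficient of 1. The first argument is fuel that makes this
    course-of-values recursion structural. *)
Fixpoint inv_coef f (b : R) fuel n : R :=
  if fuel is k.+1 then
    b * ((n == 0%N)%:R - \sum_(i < n) f i.+1 * inv_coef f b k (n - i.+1))
  else 0.

Lemma inv_coef_fuel f b k l n :
  (n < k)%N -> (n < l)%N -> inv_coef f b k n = inv_coef f b l n.
Proof.
elim: k l n => [|k IHk] [|l] n //= ltnk ltnl; congr (_ * (_ - _)).
apply: eq_bigr => i _; congr (_ * _).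
have lti : (n - i.+1 < n)%N by rewrite ltn_subrL /= (leq_ltn_trans _ (ltn_ord i)).
by apply: IHk; apply: leq_trans lti _.
Qed.

(** The usual inversion of a series, done with [b] in place of the inverse of
    [f 0]: each coefficient is off by a multiple of [f 0 * b - 1]. *)
Lemma fps_approx_inv f (b : R) :
  exists g, forall n, exists c, (f * g - 1) n = c * (f 0%N * b - 1).
Proof.
pose g : {fps R} := Fps (fun n => inv_coef f b n.+1 n).
exists g => n.
pose S := \sum_(i < n) f i.+1 * g (n - i.+1)%N.
exists ((n == 0%N)%:R - S).
have gn : g n = b * ((n == 0%N)%:R - S).
  rewrite /= /S; congr (_ * (_ - _)); apply: eq_bigr => i _; congr (_ * _).
  apply: inv_coef_fuel => //.
  by rewrite ltn_subrL /= (leq_ltn_trans _ (ltn_ord i)).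
rewrite coef_fpsB coef_fps1 coef_fpsM big_ord_recl subn0 -[\sum_(i < n) _]/S gn.
by rewrite mulrA -addrA -[S - _]opprB [RHS]mulrC [RHS]mulrBl mul1r.
Qed.

(** Modulo [M[[X]]], a series outside [M[[X]]] is associated to the monomial
    ['X^n], where [n] is the first index of a coefficient outside [M]: it is
    ['X^n * u] with [u] invertible since its constant term is. *)
Lemma fps_assoc_monomial (M : {pred R}) f :
    maximal_ideal M -> f \notin fps_over M ->
  exists n u v, f - fpsXn n * u \in fps_over M /\ u * v - 1 \in fps_over M.
Proof.
move=> maxM Mf; have idM := maxM.1.
have exf : exists n, f n \notin M.
  apply: contrapT => nof; move/negP: Mf; apply; apply/fps_overP => n.
  by apply: contrapT => /negP Mfn; apply: nof; exists n.
case: (ex_minnP exf) => n Mfn minn.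
pose u : {fps R} := Fps (fun k => f (n + k)%N).
have [b Mb] : exists b, u 0%N * b - 1 \in M.
  by apply: maximal_ideal_inv => //=; rewrite addn0.
have [v uv] := fps_approx_inv u b.
exists n, u, v; split; apply/fps_overP => k; last first.
  by have [c ->] := uv k; apply: ideal_memMl.
rewrite coef_fpsB coef_fpsXnM; case: leqP => [lenk|ltkn].
  by rewrite /= subnKC // subrr; apply: ideal_mem0.
by rewrite subr0; apply: contraLR ltkn => /minn; rewrite -leqNgt.
Qed.

End PowerSeries.

Theorem proposition3p21 (B : comNzRingType) (A : subringClosed B)
  (M : {pred B}) (hM : maximal_ideal M) (hMA : {subset M <= A}) :
  PSI_extension (fps_over A : subringClosed {fps B}).
Proof.
move=> P relP; have [idP primeP] := relP.
have idMX := fps_over_ideal hM.1.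
have MXA : {subset fps_over M <= fps_over A}.
  by move=> f /fps_overP Mf; apply/fps_overP => n; apply: hMA.
have [MXP|/existsNP[m /not_implyP[Mm /negP Pm]]] :=
  pselect {subset fps_over M <= P}; last first.
  exact: relative_prime_conductor relP idMX MXA Mm Pm.
split=> // f g Pfg; apply/orP.
have [Mf|Mf] := boolP (f \in fps_over M); first by left; apply: MXP.
have [n [u [v [/MXP fE /MXP uvE]]]] := fps_assoc_monomial hM Mf.
have PXug : fpsXn B n * u * g \in P.
  by rewrite -(ideal_mem_congr idP (_ : f * g - _ \in P)) // -mulrBl mulrC;
    apply: ideal_memMl.
have PXg : fpsXn B n * g \in P.
  rewrite -(ideal_mem_congr idP (_ : v * (fpsXn B n * u * g) - _ \in P)).
    exact: ideal_memMl.
  have -> : v * (fpsXn B n * u * g) - fpsXn B n * g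
      = fpsXn B n * g * (u * v - 1).
    by rewrite mulrBr mulr1 [v * _]mulrC [_ * u * g]mulrAC mulrA.
  exact: ideal_memMl.
have [PX|] := primeP _ _ (fpsXn_over A n) PXg; last by right.
left; rewrite (ideal_mem_congr idP fE) mulrC.
exact: ideal_memMl.
Qed.
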